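(* Let $X$ be a $\mathrm{CAT}(0)$ space. There exists a unique topology $\mathcal T_{\Delta}$ on $X$ with the following two properties: (i) A sequence $(x_n)$ in $X$ converges with respect to $\mathcal T_{\Delta}$ to a point $x\in X$ if and only if the sequence $(x_n)$ is bounded and converges to $x$ weakly. (ii) The topology $\mathcal T_{\Delta}$ is sequential.
   Context: All $\mathrm{CAT}(0)$ spaces are by definition complete and geodesic. A bounded sequence $(x_n)$ in a $\mathrm{CAT}(0)$ space $X$ converges weakly to a point $x\in X$ if for any compact geodesic $c$ in $X$ starting at $x$, the closest-point projections $\mathrm{Proj}_c(x_n)$ of $x_n$ to $c$ converge (in the metric) to $x$. A topology $\mathcal T$ is called sequential if a subset is $\mathcal T$-closed whenever it contains every $\mathcal T$-limit point of every sequence of its elements. *)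

(* Defs.v *)
From HB Require Import structures.
From mathcomp Require Import all_boot all_order all_algebra.
From mathcomp Require Import all_classical all_reals all_analysis.

Set Implicit Arguments.
Unset Strict Implicit.
Unset Printing Implicit Defensive.

Import Order.TTheory GRing.Theory Num.Theory.
Import numFieldNormedType.Exports.

Local Open Scope classical_set_scope.
Local Open Scope ring_scope.

Section CAT0_spaces.
Context {R : realType} {X : metricType R}.

(* [Complete] from the library assumes a distinguished point; this does not. *)
Definition metric_complete : Prop :=
  forall u : nat -> X, cauchy (u @ \oo) -> exists x : X, u @ \oo --> x.

(* [c] is only relevant on [0, l]; l = 0 (a constant geodesic) is allowed. *)
Definition is_geodesic (c : R -> X) (l : R) (x y : X) : Prop :=
  [/\ 0 <= l, c 0 = x, c l = y &
      forall s t, 0 <= s <= l -> 0 <= t <= l -> mdist (c s) (c t) = `|s - t|].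

Definition trace (c : R -> X) (l : R) : set X := c @` `[0, l].

Definition geodesic_space : Prop :=
  forall x y : X, exists c l, is_geodesic c l x y.

(* The library norm on row vectors is the sup norm, hence this definition. *)
Definition edist (a b : 'rV[R]_2) : R :=
  Num.sqrt (\sum_(i < 2) (a ord0 i - b ord0 i) ^+ 2).

(* p lies on the side (c, l) issued from the vertex x, and p' is its
   comparison point on the Euclidean segment [x', y']. *)
Definition comparison_on (c : R -> X) (l : R) (x : X)
    (x' y' : 'rV[R]_2) (p : X) (p' : 'rV[R]_2) : Prop :=
  [/\ trace c l p,
      exists2 t : R, 0 <= t <= 1 & p' = (1 - t) *: x' + t *: y' &
      edist x' p' = mdist x p].

Definition cat0_comparison : Prop :=
  forall (x y z : X) (a b c : R -> X) (la lb lc : R) (x' y' z' : 'rV[R]_2),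
    is_geodesic a la x y -> is_geodesic b lb y z -> is_geodesic c lc z x ->
    edist x' y' = mdist x y -> edist y' z' = mdist y z ->
    edist z' x' = mdist z x ->
    let comparison p p' :=
      [\/ comparison_on a la x x' y' p p',
          comparison_on b lb y y' z' p p' |
          comparison_on c lc z z' x' p p'] in
    forall p q p' q', comparison p p' -> comparison q q' ->
      mdist p q <= edist p' q'.

(* Junk value y when y has no closest point in A; in a CAT(0) space the closest
   point exists and is unique when A is the trace of a geodesic. *)
Definition Proj (A : set X) (y : X) : X :=
  xget y [set p | A p /\ forall q, A q -> mdist y p <= mdist y q].

Definition bounded_seq (u : nat -> X) : Prop :=
  exists (o : X) (M : R), forall n, mdist o (u n) <= M.

Definition weakly_converges (u : nat -> X) (x : X) : Prop :=
  forall (c : R -> X) (l : R) (y : X), is_geodesic c l x y ->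
    (fun n => Proj (trace c l) (u n)) @ \oo --> x.

End CAT0_spaces.

Arguments metric_complete {R} X.
Arguments geodesic_space {R} X.
Arguments cat0_comparison {R} X.

Definition CAT0 {R : realType} (X : metricType R) : Prop :=
  [/\ metric_complete X, geodesic_space X & cat0_comparison X].

(* A topology is given by its family of open sets, since [X] already carries the
   metric topology as canonical structure. *)
Section topologies.
Context {X : Type}.
Implicit Type T : set (set X).

(* The empty set is the union of the empty family. *)
Definition is_topology T : Prop :=
  [/\ T setT,
      forall A B, T A -> T B -> T (A `&` B) &
      forall S : set (set X), S `<=` T -> T (\bigcup_(A in S) A)].

Definition topology_closed T (A : set X) : Prop := T (~` A).

Definition converges_in T (u : nat -> X) (x : X) : Prop :=
  forall U, T U -> U x -> \forall n \near \oo, U (u n).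

Definition sequential T : Prop :=
  forall A : set X,
    (forall (u : nat -> X) (x : X),
       (forall n, A (u n)) -> converges_in T u x -> A x) ->
    topology_closed T A.

End topologies.

(* Main.v *)
Require Import Defs.
From mathcomp Require Import all_boot all_order all_algebra.
From mathcomp Require Import all_classical all_reals all_analysis.

(* Bounded weak convergence is an L*-convergence in the sense of Frechet and
   Urysohn: constant sequences converge, subsequences inherit limits, limits are
   unique, and a sequence converges to x as soon as each of its subsequences has
   a further subsequence converging to x.  The sequentially open sets of any such
   convergence form a topology, and by a theorem of Kisynski the convergence of
   sequences in it is the original one.  Uniqueness of weak limits comes from
   projecting to a geodesic joining two limits. *)

Import Order.TTheory GRing.Theory Num.Theory.

Local Open Scope classical_set_scope.
Local Open Scope ring_scope.

(* Subsequences are reindexings along maps tending to infinity, not necessarily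
   increasing ones. *)
Lemma not_near_subseq (P : nat -> Prop) :
  ~ (\forall n \near \oo, P n) ->
  exists2 f : nat -> nat, f @ \oo --> \oo & forall n, ~ P (f n).
Proof.
move=> nP; have ex N : exists n, (N <= n)%N /\ ~ P n.
  apply: contra_notP nP => /forallNP nE; exists N => // n /= Nn.
  by apply: contrapT => nPn; apply: (nE n).
have [f fP] := choice ex; exists f; last by move=> n; case: (fP n).
by apply/cvgnyPge => A; exists A => // n /= An; apply: leq_trans An (fP n).1.
Qed.

Lemma near_subseq {P : nat -> Prop} :
  (\forall n \near \oo, P n) ->
  exists2 f : nat -> nat, f @ \oo --> \oo & forall n, P (f n).
Proof.
move=> [N _ NP]; exists (fun n => n + N)%N; first exact: cvg_addnr.
by move=> n; apply: NP; rewrite /= leq_addl.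
Qed.

(** If [v] takes no value of [w] infinitely often, the indices chosen for its terms repeat each
    number only finitely often, hence tend to infinity. *)
Lemma subseq_range {T : Type} {w v : nat -> T} :
  (forall m, range w (v m)) ->
  (exists k, exists2 f : nat -> nat, f @ \oo --> \oo & forall n, v (f n) = w k) \/
  (exists2 k : nat -> nat, k @ \oo --> \oo & v = w \o k).
Proof.
move=> vw; have [[k kv]|nfreq] :=
  pselect (exists k, ~ \forall n \near \oo, v n <> w k).
  have [f foo fk] := not_near_subseq _ kv.
  by left; exists k, f => // n; apply: contrapT; apply: fk.
right; have ex m : exists k, w k = v m by have [k _] := vw m; exists k.
have [k kP] := choice ex; exists k; last by apply: funext => n /=.
have away j : \forall n \near \oo, k n <> j.
  have : \forall n \near \oo, v n <> w j by apply: contra_notP nfreq; exists j.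
  by apply: filterS => n vn kn; apply: vn; rewrite -kP kn.
apply/cvgnyPge; elim=> [|A IHA]; first exact: nearW.
have := away A; apply: filterS2 IHA => n; rewrite leq_eqVlt.
by move=> /orP[/eqP/esym|].
Qed.

Definition seq_open {X : Type} (conv : (nat -> X) -> X -> Prop) : set (set X) :=
  [set A | forall u x, (forall n, ~ A (u n)) -> conv u x -> ~ A x].

(** Source of uniqueness: a sequential topology is determined by its convergent sequences. *)
Lemma sequential_topologyE {X : Type} (T : set (set X)) :
  sequential T -> T = seq_open (converges_in T).
Proof.
move=> seqT; apply/seteqP; split=> A /= TA.
  move=> u x nAu ux Ax; have [n] := filter_ex (ux _ TA Ax); exact: nAu.
rewrite -[A]setCK; apply: seqT => u x nAu ux; exact: TA nAu ux.
Qed.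

Section Lstar_convergence.
Context {X : Type} (conv : (nat -> X) -> X -> Prop).

Hypothesis conv_const : forall x, conv (fun=> x) x.
Hypothesis conv_subseq : forall u x (f : nat -> nat),
  f @ \oo --> \oo -> conv u x -> conv (u \o f) x.
Hypothesis conv_unique : forall u x y, conv u x -> conv u y -> x = y.
Hypothesis conv_urysohn : forall u x,
  (forall f : nat -> nat, f @ \oo --> \oo ->
     exists2 g : nat -> nat, g @ \oo --> \oo & conv (u \o f \o g) x) ->
  conv u x.

Lemma seq_open_topology : is_topology (seq_open conv).
Proof.
split.
- by move=> u x nu; have /(_ I) := nu 0%N.
- move=> A B oA oB u x nAB ux [Ax Bx].
  (* A sequence missing the intersection has a subsequence missing [A], or one inside [A] and so
     missing [B]. *)
  have [nearA|/not_near_subseq[f foo nAf]] :=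
    pselect (\forall n \near \oo, A (u n)); last first.
    exact: oA nAf (conv_subseq _ _ _ foo ux) Ax.
  have [f foo Af] := near_subseq nearA.
  apply: oB (conv_subseq _ _ _ foo ux) Bx => n Bf; exact: (nAB (f n)).
- move=> S oS u x nu ux [A SA Ax].
  apply: (oS A SA u x _ ux Ax) => n Au; apply: (nu n); by exists A.
Qed.

Lemma conv_converges_in u x : conv u x -> converges_in (seq_open conv) u x.
Proof.
move=> ux U oU Ux; apply: contrapT => /not_near_subseq[f foo nUf].
exact: oU nUf (conv_subseq _ _ _ foo ux) Ux.
Qed.

(** A convergent sequence in [range w] either has a constant subsequence, which fixes its limit, or
    is itself a subsequence of [w], where the hypothesis applies. *)
Lemma seq_open_setC_range w :
  (forall (k : nat -> nat) p, k @ \oo --> \oo -> conv (w \o k) p -> range w p) ->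
  seq_open conv (~` range w).
Proof.
move=> wP v p vw vp; apply; have {}vw m : range w (v m) := contrapT (vw m).
have [[k [f foo vf]]|[k koo vk]] := subseq_range vw.
  exists k => //; apply: (conv_unique (fun=> w k)); first exact: conv_const.
  by have := conv_subseq _ _ _ foo vp; congr conv; apply: funext => n; apply: vf.
by apply: wP koo _; rewrite -vk.
Qed.

(* If [u] failed to converge to [x], some subsequence [w] avoiding [x] would have
   no subsequence converging to [x].  Either [range w] is already sequentially
   closed, or some subsequence of [w] converges to some y <> x, and its range
   together with [y] is sequentially closed; both contradict [u] tending to [x]. *)
Theorem converges_in_conv u x : converges_in (seq_open conv) u x -> conv u x.
Proof.
move=> ux; apply: conv_urysohn => f0 f0oo; apply: contrapT => nconv.
(* Hitting [x] infinitely often would give a constant subsequence, which converges to [x]. *)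
have nearNx : \forall n \near \oo, u (f0 n) <> x.
  apply: contrapT => /not_near_subseq[g goo gx]; apply: nconv.
  exists g => //; rewrite (_ : _ \o g = fun=> x) //.
  by apply: funext => n /=; apply: contrapT; apply: gx.
have [h hoo hx] := near_subseq nearNx.
pose w := u \o f0 \o h.
have wx : converges_in (seq_open conv) w x.
  by move=> U oU Ux; exact: hoo _ (f0oo _ (ux U oU Ux)).
have [[y [k koo wky]]|none] :=
  pselect (exists y, exists2 k : nat -> nat, k @ \oo --> \oo & conv (w \o k) y).
- have yx : y <> x.
    move=> yx; apply: nconv; exists (h \o k); last by rewrite -yx.
    exact: cvg_comp koo hoo.
  pose w' n := if n is m.+1 then w (k m) else y.
  have o : seq_open conv (~` range w').
    apply: seq_open_setC_range => j p joo w'p; exists 0%N => //=.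
    (* Index [0] of [w'] is the added point [y]. Once it is avoided, [predn] undoes the shift and
       leaves a subsequence of [w \o k], which forces [p = y]. *)
    have [g goo gj] := near_subseq ((cvgnyPge _).1 joo 1%N).
    apply: (conv_unique (w' \o j \o g)); last exact: conv_subseq goo w'p.
    rewrite (_ : w' \o j \o g = w \o k \o (predn \o j \o g)); last first.
      by apply: funext => n /=; case: (j (g n)) (gj n).
    apply: conv_subseq wky; apply/cvgnyPge => A.
    have /cvgnyPge/(_ A.+1) := cvg_comp _ _ goo joo.
    by apply: filterS => n /=; case: (j (g n)).
  have w'x : (~` range w') x by move=> [[|n] _]; [exact: yx|exact: hx].
  have /filter_ex[n] : \forall n \near \oo, ~ range w' (w (k n)) :=
    koo _ (wx _ o w'x).
  by case; exists n.+1.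
- have o : seq_open conv (~` range w).
    by apply: seq_open_setC_range => k p koo wp; case: none; exists p, k.
  have rwx : (~` range w) x by move=> [n _]; exact: hx.
  by have [n []] := filter_ex (wx _ o rwx); exists n.
Qed.

End Lstar_convergence.

Section weak_convergence.
Context {R : realType} {X : metricType R}.
Implicit Types (u : nat -> X) (x y : X).

Lemma Proj_id (A : set X) x : A x -> Proj A x = x.
Proof.
(* The default value of [Proj A x] is [x] itself, so only a genuine closest point needs an
   argument. *)
move=> Ax; rewrite /Proj; case: xgetP => // p -> [_ /(_ x Ax)].
by rewrite mdistxx => dp; apply/esym/mdist_positivity/le_anti; rewrite dp mdist_ge0.
Qed.

Lemma geodesic_start (c : R -> X) l x y : is_geodesic c l x y -> trace c l x.
Proof. by case=> l0 <- _ _; exists 0; rewrite //= in_itv /= lexx. Qed.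

Lemma geodesic_rev (c : R -> X) l x y :
  is_geodesic c l x y -> is_geodesic (fun t => c (l - t)) l y x.
Proof.
case=> l0 c0 cl cd; split; rewrite ?subr0 ?subrr // => s t /andP[s0 sl] /andP[t0 tl].
by rewrite cd ?subr_ge0 ?sl ?tl ?gerBl // opprB addrC addrA subrK distrC.
Qed.

Lemma trace_rev (c : R -> X) l : trace (fun t => c (l - t)) l = trace c l.
Proof.
apply/seteqP; split=> _ [t /= + <-]; rewrite in_itv /= => /andP[t0 tl];
  exists (l - t); rewrite ?subKr //= in_itv /= subr_ge0 tl gerBl //.
Qed.

Lemma weakly_converges_const x : weakly_converges (fun=> x) x.
Proof.
move=> c l y /geodesic_start xc; rewrite Proj_id //; exact: cvg_cst.
Qed.

Lemma weakly_converges_subseq u x (f : nat -> nat) :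
  f @ \oo --> \oo -> weakly_converges u x -> weakly_converges (u \o f) x.
Proof. by move=> foo ux c l y /ux; apply: cvg_comp. Qed.

(** A geodesic from [x] to [y] and its reverse have the same trace, so the projections to it tend to
    both endpoints. *)
Lemma weakly_converges_unique u x y : geodesic_space X ->
  weakly_converges u x -> weakly_converges u y -> x = y.
Proof.
move=> geoX ux uy; have [c [l cP]] := geoX x y.
have := uy _ _ _ (geodesic_rev _ _ _ _ cP); rewrite trace_rev => cy.
exact: (cvg_unique (@metric_hausdorff R X)) (ux _ _ _ cP) cy.
Qed.

(** Failure on one geodesic leaves a subsequence whose projections stay at distance at least [e]
    from [x], as do those of its subsequences. *)
Lemma weakly_converges_urysohn u x :
  (forall f : nat -> nat, f @ \oo --> \oo ->
     exists2 g : nat -> nat, g @ \oo --> \oo & weakly_converges (u \o f \o g) x) ->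
  weakly_converges u x.
Proof.
move=> H c l y cP; apply/metricType_numDomainType.cvgrPdist_lt => e e0.
apply: contrapT => /not_near_subseq[f /H[g _ fg] nf].
have /metricType_numDomainType.cvgrPdist_lt/(_ _ e0) := fg _ _ _ cP.
by move=> /filter_ex[n /nf].
Qed.

Lemma bounded_seq_subseq u (f : nat -> nat) :
  bounded_seq u -> bounded_seq (u \o f).
Proof. by move=> [p [M uM]]; exists p, M; move=> n; apply: uM. Qed.

Lemma bounded_seq_near u (o : X) (M : R) :
  (\forall n \near \oo, mdist o (u n) <= M) -> bounded_seq u.
Proof.
move=> [N _ NM]; exists o, (`|M| + \sum_(i < N) mdist o (u i)); move=> n.
have [Nn|nN] := leqP N n.
  apply: le_trans (NM n Nn) _; apply: le_trans (ler_norm M) _.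
  by rewrite lerDl sumr_ge0 // => i _; apply: mdist_ge0.
rewrite (bigD1 (Ordinal nN)) //= addrCA lerDl addr_ge0 // sumr_ge0 // => i _.
exact: mdist_ge0.
Qed.

(** An unbounded sequence has a subsequence whose [n]-th term is farther than [n] from [u 0]; no
    further subsequence is bounded. *)
Lemma bounded_seq_urysohn u :
  (forall f : nat -> nat, f @ \oo --> \oo ->
     exists2 g : nat -> nat, g @ \oo --> \oo & bounded_seq (u \o f \o g)) ->
  bounded_seq u.
Proof.
move=> H; apply: contrapT => nbd; pose o := u 0%N.
have ex n : exists m, (n <= m)%N /\ n%:R < mdist o (u m).
  apply: contra_notP nbd => /forallNP nE.
  apply: (@bounded_seq_near u o n%:R); exists n => // m /= nm.
  by rewrite leNgt; apply/negP => um; apply: (nE m).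
have [f fP] := choice ex.
have [|g goo [p [M fgM]]] := H f.
  by apply/cvgnyPge => A; exists A => // n /= An; apply: leq_trans An (fP n).1.
have /filter_ex[n] : \forall n \near \oo, mdist o p + M <= (g n)%:R.
  exact: goo _ (nbhs_infty_ger (mdist o p + M)).
apply/negP; rewrite -ltNge; apply: lt_le_trans (fP (g n)).2 _.
by apply: le_trans (metric_triangle _ p _) _; rewrite lerD2l; apply: fgM.
Qed.

End weak_convergence.

Theorem theorem1p2 (R : realType) (X : metricType R) (hX : CAT0 X) :
  exists! T : set (set X),
    [/\ is_topology T,
        (forall (u : nat -> X) (x : X),
           converges_in T u x <-> bounded_seq u /\ weakly_converges u x) &
        sequential T].
Proof.
have [_ geoX _] := hX.
pose conv (u : nat -> X) (x : X) := bounded_seq u /\ weakly_converges u x.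
have cconst x : conv (fun=> x) x.
  split; last exact: weakly_converges_const.
  by exists x, 0; move=> n; rewrite mdistxx.
have csubseq u x (f : nat -> nat) : f @ \oo --> \oo -> conv u x -> conv (u \o f) x.
  by move=> foo [bu ux]; split;
    [exact: bounded_seq_subseq | exact: weakly_converges_subseq].
have cunique u x y : conv u x -> conv u y -> x = y.
  by move=> [_ ux] [_ uy]; apply: weakly_converges_unique ux uy.
have curysohn u x :
    (forall f : nat -> nat, f @ \oo --> \oo ->
       exists2 g : nat -> nat, g @ \oo --> \oo & conv (u \o f \o g) x) ->
    conv u x.
  move=> H; split; [apply: bounded_seq_urysohn|apply: weakly_converges_urysohn];
    by move=> f /H[g goo []]; exists g.
have convE u x : converges_in (seq_open conv) u x <-> conv u x.
  by split; [exact: converges_in_conv|exact: conv_converges_in].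
exists (seq_open conv); split.
  split=> //; first exact: seq_open_topology.
  move=> A closedA u x uA ux Ax; apply: (Ax).
  apply: (closedA u x); first by move=> n; apply: contrapT; apply: uA.
  by apply/convE.
(* [T] is recovered from its own convergence, which [TE] identifies with [conv]. *)
move=> T [_ TE seqT]; rewrite (sequential_topologyE T seqT).
congr seq_open; apply: funext => u; apply: funext => x.
by apply/esym/propext; apply: TE.
Qed.
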